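(* Let $H$ be a finite supersoluble group acting via automorphisms on a finite abelian group $N$, and suppose the induced semidirect product $N\rtimes H$ acts on some non-empty set $\Omega$ in such a way that the restricted action of $N$ on $\Omega$ is transitive. Suppose that for each prime $p$ there exist a Sylow $p$-subgroup $P$ of $H$ and an element of $\Omega$ that is fixed by every element of $P$. Then there exists an $H$-invariant element $\omega\in\Omega$, that is, an element $\omega\in\Omega$ with $h\cdot\omega=\omega$ for all $h\in H$.
   Context: Groups act from the left; $N$ and $H$ are identified with the corresponding subgroups of $N\rtimes H$. A group $X$ is supersoluble if it possesses a series $1=X_0\leq X_1\leq\dots\leq X_s=X$ with each $X_i$ normal in $X$ and each quotient $X_{i+1}/X_i$ cyclic for $0\leq i<s$. *)

(* Defs.v *)
From HB Require Import structures.
From mathcomp Require Import all_boot all_fingroup all_solvable.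

Set Implicit Arguments.
Unset Strict Implicit.
Unset Printing Implicit Defensive.

Local Open Scope group_scope.

Section Supersoluble.

Variable gT : finGroupType.

Definition normal_cyclic_factor (G V U : {set gT}) : bool :=
  [&& V <| G, U <| G, V \subset U & cyclic (U / V)].

(* The series is 1 :: s, so s lists the terms of index >= 1;
   s = [::] is allowed and gives G = 1. *)
Definition supersoluble (G : {group gT}) : Prop :=
  exists s : seq {group gT},
    path (group_rel_of (normal_cyclic_factor G)) 1%G s /\ last 1%G s = G.

End Supersoluble.

(* MathComp's [transitive _, on _ | _] and 'Fix_to(_) are available only for
   actions on a finType; the following are the same notions on a bare type. *)
Section ActionsOnTypes.

Variables (gT : finGroupType) (T : Type) (to : {action gT &-> T}).

Definition transitive_on_type (A : {set gT}) : Prop :=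
  forall x y : T, exists2 a, a \in A & to x a = y.

Definition fixed_by (A : {set gT}) (x : T) : Prop :=
  forall a, a \in A -> to x a = x.

End ActionsOnTypes.

(* Actions here are right actions, as everywhere in MathComp: a left action
   g . x corresponds to the right action x g = g^-1 . x, which has the same
   orbits and the same fixed points. *)

(* Main.v *)
Require Import Defs.
From mathcomp Require Import all_boot all_fingroup all_solvable.
From mathcomp Require Import ssralg.

(** The action of N makes Omega an affine space over the quotient of N by the
    stabiliser of a point: since N is abelian and transitive, that stabiliser
    is the same for all points.  In such an affine space, points with integer
    weights of total weight 1 have a barycentre, and the group H, which acts
    by affine maps, preserves barycentres.  If y is fixed by a Sylow
    p-subgroup P of H, the H-orbit of y, listed as y a for P a ranging over
    the cosets of P in H, is an H-invariant family of #|H : P| points.  These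
    indices, for all p, have no common prime factor, so some integer
    combination of them is 1; weighting the families by the coefficients gives
    an H-invariant family of total weight 1, and its barycentre is fixed by H.

    The barycentre is expressed through a base point w.  The predicate
    [invariant_weight w m] below says that some formal combination of points
    of total weight m has an H-invariant sum; [invariant_weight_index]
    provides the weights #|H : P|, [invariant_weight_gcd] combines weights,
    and [invariant_weight1] reads off a fixed point from weight 1.

    In cohomological terms, the displacements of w form a 1-cocycle of H
    with values in the quotient of N by the stabiliser of w,
    [invariant_weight w m] says that m kills its class, and
    [invariant_weight_index] is the identity that corestriction after
    restriction is multiplication by the index. *)

Local Open Scope group_scope.
Import GRing.Theory FiniteModule.

Section TypeAction.

Set Implicit Arguments.
Unset Strict Implicit.

Variables (gT : finGroupType) (T : Type) (act : {action gT &-> T}).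

Lemma type_actM x a b : act x (a * b) = act (act x a) b.
Proof.
have [_ actM] : is_action setT act by case: act.
by rewrite actM ?inE.
Qed.

Lemma type_act1 x : act x 1 = x.
Proof.
have [act_inj _] : is_action setT act by case: act.
by apply: (act_inj 1); rewrite -type_actM mulg1.
Qed.

Lemma type_actCJ x a b : act (act x a) b = act (act x b) (a ^ b).
Proof. by rewrite -!type_actM -conjgC. Qed.

End TypeAction.

Section Barycentre.

Set Implicit Arguments.
Unset Strict Implicit.

Variables (gT : finGroupType) (T : Type) (act : {action gT &-> T}).
Variables (N H : {group gT}) (abelN : abelian N).
Hypothesis nNH : H \subset 'N(N).
Hypothesis transN : transitive_on_type act N.

Implicit Types (w x y : T) (u v : fmod_of abelN) (m n : nat).

Let translate x v := act x (val v).
Local Notation "x +: v" := (translate x v) (at level 50, left associativity).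

Let translateD x u v : x +: (u + v)%R = x +: u +: v.
Proof. by rewrite /translate fmvalA type_actM. Qed.

(** Since N is abelian, u can be applied last.  Thus agreeing at one point is
    a congruence on N, and it serves in place of equality in the quotient of
    N by the stabiliser. *)
Let translate_addl x u v v' :
  x +: v = x +: v' -> x +: (u + v)%R = x +: (u + v')%R.
Proof. by move=> eq_vv'; rewrite ![(u + _)%R]addrC !translateD eq_vv'. Qed.

Let translateN x u v : x +: u = x +: v -> x +: (- u)%R = x +: (- v)%R.
Proof.
move=> eq_uv; have /esym := translate_addl (- u - v)%R eq_uv.
by rewrite subrK addrAC addNr add0r.
Qed.

Let translateMn x u v m : x +: u = x +: v -> x +: (u *+ m)%R = x +: (v *+ m)%R.
Proof.
move=> eq_uv; elim: m => [|m IHm]; first by rewrite !mulr0n.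
by rewrite !mulrS (translate_addl _ IHm) !translateD eq_uv.
Qed.

Let translate_sum (I : finType) (A : {set I}) (F G : I -> fmod_of abelN) x :
    {in A, forall i, x +: F i = x +: G i} ->
  x +: (\sum_(i in A) F i)%R = x +: (\sum_(i in A) G i)%R.
Proof.
move=> eqFG; elim/big_rec2: _ => // i u v Ai eq_uv.
by rewrite (translate_addl _ eq_uv) !translateD eqFG.
Qed.

Let translate_act x v h : h \in H -> act (x +: v) h = act x h +: (v ^@ h)%R.
Proof. by move=> Hh; rewrite /translate fmvalJ ?(subsetP nNH) // type_actCJ. Qed.

Let translate_exists x y : exists v, x +: v = y.
Proof.
have [a Na <-] := transN x y.
by exists (fmod abelN a); rewrite /translate fmodK.
Qed.

(** A family of m points w + v_i has sum m w + v, with v the sum of the v_i.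
    An element h of H with w h = w + u moves that sum to
    m w + (v ^ h + m u), so the equation says that the sum is invariant;
    it is compared after translating w because translations matter only
    modulo the stabiliser of w. *)
Definition invariant_weight w m :=
  exists v, forall h u, h \in H -> act w h = w +: u ->
    w +: (v ^@ h + u *+ m)%R = w +: v.

(** The invariant family is the H-orbit of y, counted with multiplicity: the
    coset P a contributes y a, and right multiplication by h permutes the
    cosets. *)
Lemma invariant_weight_index (P : {group gT}) w y :
  P \subset H -> fixed_by act P y -> invariant_weight w #|H : P|.
Proof.
move=> sPH fixP.
have [g def_g] :=
  fin_all_exists (fun C : {set gT} => translate_exists w (act y (repr C))).
have gE a : w +: g (P :* a) = act y a.
  by rewrite def_g; case: repr_rcosetP => b Pb; rewrite type_actM fixP.
exists (\sum_(C in rcosets P H) g C)%R => h u Hh def_u.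
have PHh : [acts H, on rcosets P H | 'Rs] by apply: actsRs_rcosets.
rewrite [in RHS](reindex_acts 'Rs PHh Hh).
rewrite (big_morph _ (actAr h) (act0r _ h)) -sumr_const -big_split /=.
apply: translate_sum => _ /rcosetsP[a _ ->].
rewrite addrC translateD -def_u -translate_act // gE.
by rewrite rcosetE -rcosetM gE type_actM.
Qed.

Lemma invariant_weightM w m n : invariant_weight w m -> invariant_weight w (n * m).
Proof.
move=> [v inv_v]; exists (v *+ n)%R => h u Hh def_u.
by rewrite actZr mulnC mulrnA -mulrnDl; apply/translateMn/inv_v.
Qed.

Lemma invariant_weightB w m n : n <= m ->
  invariant_weight w m -> invariant_weight w n -> invariant_weight w (m - n).
Proof.
move=> le_nm [v inv_v] [v' inv_v']; exists (v - v')%R => h u Hh def_u.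
rewrite actAr actNr mulrnBr // addrACA -opprD.
rewrite (translate_addl _ (translateN (inv_v' h u Hh def_u))).
by rewrite translateD inv_v // translateD.
Qed.

Lemma invariant_weight_gcd w m n : 0 < m ->
  invariant_weight w m -> invariant_weight w n -> invariant_weight w (gcdn m n).
Proof.
move=> m_gt0 inv_m inv_n; case: (egcdnP n m_gt0) => km kn def_gcd _.
rewrite -(addKn (kn * n) (gcdn m n)) -def_gcd.
apply: invariant_weightB; [by rewrite def_gcd leq_addr | |];
  exact: invariant_weightM.
Qed.

Lemma invariant_weight1 w : invariant_weight w 1 -> exists x, fixed_by act H x.
Proof.
case=> v inv_v; exists (w +: v) => h Hh.
have [u def_u] := translate_exists w (act w h).
by rewrite translate_act // -def_u -translateD addrC -[u]mulr1n inv_v.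
Qed.

(** The trivial subgroup fixes every point, so #|H| is a weight to start from.
    Replacing a weight d > 1 by its gcd with #|H : P|, for P a Sylow
    p-subgroup and p a prime divisor of d, makes it strictly smaller because
    p does not divide that index; hence the descent ends at weight 1. *)
Lemma fixed_point_of_Sylow w :
    (forall p : nat, prime p ->
       exists2 P : {group gT}, p.-Sylow(H) P & exists x, fixed_by act P x) ->
  exists x, fixed_by act H x.
Proof.
move=> fixSyl.
have: exists2 d, 0 < d & invariant_weight w d.
  exists #|H : 1%G|; first exact: indexg_gt0.
  apply: (@invariant_weight_index _ _ w (sub1G H)) => _ /set1P->.
  exact: type_act1.
case=> d; elim/ltn_ind: d => d IHd d_gt0 inv_d.
have [d_le1 | d_gt1] := leqP d 1.
  have d1 : d = 1%N by apply/eqP; rewrite eqn_leq d_le1.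
  by apply: (@invariant_weight1 w); rewrite -d1.
have [P sylP [y fixP]] := fixSyl _ (pdiv_prime d_gt1).
have inv_P := invariant_weight_index w (pHall_sub sylP) fixP.
have p'P : ~~ (pdiv d %| #|H : P|).
  by rewrite -p'natE ?pdiv_prime //; case/and3P: sylP.
apply: (IHd (gcdn d #|H : P|)); last exact: invariant_weight_gcd.
- rewrite ltn_neqAle dvdn_leq ?dvdn_gcdl // andbT.
  by apply: contra p'P => /eqP/gcdn_idPl; apply/dvdn_trans/pdiv_dvd.
- by rewrite gcdn_gt0 d_gt0.
Qed.

End Barycentre.

Theorem corollary2 (aT rT : finGroupType) (H : {group aT}) (N : {group rT})
    (to : groupAction H N) (Omega : Type)
    (act : {action (sdprod_by to) &-> Omega}) :
  supersoluble H ->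
  abelian N ->
  inhabited Omega ->
  transitive_on_type act (sdpair1 to @* N) ->
  (forall p : nat, prime p ->
     exists2 P : {group aT}, p.-Sylow(H) P &
       exists omega : Omega, fixed_by act (sdpair2 to @* P) omega) ->
  exists omega : Omega, fixed_by act (sdpair2 to @* H) omega.
Proof.
move=> _ abelN [w] transN fixSyl.
apply: (fixed_point_of_Sylow (morphim_abelian (sdpair1 to) abelN)
          (im_sdpair_norm to) transN w) => p /fixSyl[P sylP fixP].
by exists (sdpair2 to @* P)%G => //; apply: morphim_pHall => //; apply: pHall_sub sylP.
Qed.
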